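(* Let $G$ be a finitely generated nilpotent group and let $\Lambda\leq\mathrm{Out}(G)$ be a subgroup. If the natural homomorphism $\Lambda\to\mathrm{Out}(G_{\mathrm{ab}})$ given by the action on the abelianisation $G_{\mathrm{ab}}=G/[G,G]$ has the congruence subgroup property, then the inclusion $\Lambda\to\mathrm{Out}(G)$ has the congruence subgroup property.
   Context: For a group $G$, a finite characteristic quotient is a surjection $q\colon G\to Q$ onto a finite group whose kernel is a characteristic subgroup of $G$; it induces a homomorphism $q_\star\colon\mathrm{Out}(G)\to\mathrm{Out}(Q)$ of outer automorphism groups. Let $\lambda\colon\Lambda\to\mathrm{Out}(G)$ be a group homomorphism. A congruence subgroup of $\Lambda$ (with respect to $\lambda$) is any subgroup of the form $(q_\star\circ\lambda)^{-1}(H)$, where $q\colon G\to Q$ is a finite characteristic quotient of $G$ and $H\leq\mathrm{Out}(Q)$ is any subgroup. The homomorphism $\lambda$ has the congruence subgroup property (CSP) if every finite-index subgroup of $\Lambda$ containing $\ker\lambda$ is a congruence subgroup. The CSP of $\Lambda\to\mathrm{Out}(G_{\mathrm{ab}})$ is this notion with $G_{\mathrm{ab}}$ in place of $G$. *)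

(* Defs.v *)
(* Groups are [groupType]s, which may be infinite; subsets are classical. *)
From HB Require Import structures.
From mathcomp Require Import all_boot.
From mathcomp Require Import boolp classical_sets functions cardinality.

Set Implicit Arguments.
Unset Strict Implicit.
Unset Printing Implicit Defensive.

Local Open Scope classical_set_scope.
Local Open Scope quotient_scope.
Local Open Scope group_scope.

Section Subgroups.
Context {G : groupType}.
Implicit Types A B : set G.

Definition subgroup A : Prop := group_closed [in A].

Lemma subgroupP A :
  subgroup A <->
  [/\ A 1, forall x y, A x -> A y -> A (x * y) & forall x, A x -> A x^-1].
Proof.
split=> [gA | [A1 AM AV]].
  split; first by move: gA.1; rewrite !inE.
  - by move=> x y Ax Ay; have := group_closedM gA (mem_set Ax) (mem_set Ay);
      rewrite inE.
  - by move=> x Ax; have := group_closedV gA (mem_set Ax); rewrite inE.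
split=> [|x y]; rewrite !inE // => Ax Ay.
by apply: AM => //; apply: AV.
Qed.

Definition generated A : set G := smallest subgroup A.

Definition commutator A B : set G :=
  generated [set [~ x, y] | x in A & y in B].

Lemma generated_subgroup A : subgroup (generated A).
Proof.
apply/subgroupP; split=> [B [/subgroupP[] //]|x y gx gy B|x gx B] BA.
  by have [/subgroupP[_ BM _] _] := BA; apply: BM; [apply: gx|apply: gy].
by have [/subgroupP[_ _ BV] _] := BA; apply: BV; apply: gx.
Qed.

Definition finite_index A : Prop :=
  finite_set (range (fun x : G => [set x * a | a in A])).

Definition normal A : Prop := forall x y, A x -> A (x ^ y).

Fixpoint lower_central (n : nat) : set G :=
  if n is m.+1 then commutator (lower_central m) setT else setT.

End Subgroups.

Definition nilpotent (G : groupType) : Prop :=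
  exists n, lower_central n = [set 1 : G].

Definition finitely_generated (G : groupType) : Prop :=
  exists2 A : set G, finite_set A & generated A = setT.

Record normalSubgroup (G : groupType) := NormalSubgroup {
  nsub :> set G;
  nsub_subgroup : subgroup nsub;
  nsub_normal : normal nsub }.

Section Quotient.
Context {G : groupType} (N : normalSubgroup G).
Implicit Types x y : G.

Definition coset_rel x y : bool := `[< nsub N (x^-1 * y) >].

Let NP := (subgroupP N).1 (nsub_subgroup N).

Lemma coset_rel_equiv : equiv_class_of coset_rel.
Proof.
have [N1 NM NV] := NP.
split=> [x|x y|y x z]; first by apply/asboolP; rewrite mulVg.
- by apply/asboolP/asboolP=> /NV; rewrite invgM invgK.
- move=> /asboolP xy /asboolP yz; apply/asboolP.
  by have := NM _ _ xy yz; rewrite mulgA mulgK.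
Qed.

Canonical coset_equiv := EquivRelPack coset_rel_equiv.

Definition quotient_group := {eq_quot coset_rel}.

HB.instance Definition _ := Choice.on quotient_group.
HB.instance Definition _ := EqQuotient.on quotient_group.

Definition coset (x : G) : quotient_group := \pi_quotient_group x.

Lemma coset_eq x y : coset x = coset y <-> nsub N (x^-1 * y).
Proof. by split=> [/eqmodP/asboolP|xy]; last exact/eqmodP/asboolP. Qed.

Lemma coset_surj (u : quotient_group) : exists x, coset x = u.
Proof. by exists (repr u); rewrite /coset reprK. Qed.

Definition quo_mul (u v : quotient_group) : quotient_group :=
  coset (repr u * repr v).
Definition quo_inv (u : quotient_group) : quotient_group := coset (repr u)^-1.

Lemma quo_mulE x y : quo_mul (coset x) (coset y) = coset (x * y).
Proof.
have [N1 NM NV] := NP.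
have /coset_eq Hx : coset (repr (coset x)) = coset x by rewrite /coset reprK.
have /coset_eq Hy : coset (repr (coset y)) = coset y by rewrite /coset reprK.
apply/coset_eq; set a := repr _ in Hx *; set b := repr _ in Hy *.
have -> : (a * b)^-1 * (x * y) = ((a^-1 * x) ^ b) * (b^-1 * y).
  by rewrite /conjg invgM !mulgA mulgK.
by apply: NM => //; apply: nsub_normal.
Qed.

Lemma quo_invE x : quo_inv (coset x) = coset x^-1.
Proof.
have [N1 NM NV] := NP.
have /coset_eq Hx : coset (repr (coset x)) = coset x by rewrite /coset reprK.
apply/coset_eq; set a := repr _ in Hx *; rewrite invgK.
have -> : a * x^-1 = ((a^-1 * x)^-1) ^ a^-1.
  by rewrite /conjg !invgM !invgK !mulgA mulgK.
by apply/nsub_normal/NV.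
Qed.

Lemma quo_mulA : associative quo_mul.
Proof.
move=> u v w; case: (coset_surj u) (coset_surj v) (coset_surj w).
by move=> x <- [y <-] [z <-]; rewrite !quo_mulE mulgA.
Qed.
Lemma quo_mul1 : left_id (coset 1) quo_mul.
Proof. by move=> u; case: (coset_surj u) => x <-; rewrite quo_mulE mul1g. Qed.
Lemma quo_mulr1 : right_id (coset 1) quo_mul.
Proof. by move=> u; case: (coset_surj u) => x <-; rewrite quo_mulE mulg1. Qed.
Lemma quo_mulV : left_inverse (coset 1) quo_inv quo_mul.
Proof.
by move=> u; case: (coset_surj u) => x <-; rewrite quo_invE quo_mulE mulVg.
Qed.
Lemma quo_mulrV : right_inverse (coset 1) quo_inv quo_mul.
Proof.
by move=> u; case: (coset_surj u) => x <-; rewrite quo_invE quo_mulE mulgV.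
Qed.

HB.instance Definition _ := isGroup.Build quotient_group
  quo_mulA quo_mul1 quo_mulr1 quo_mulV quo_mulrV.

Lemma coset_monoid_morphism : monoid_morphism coset.
Proof. by split=> // x y; rewrite -quo_mulE. Qed.

HB.instance Definition _ :=
  isUMagmaMorphism.Build G quotient_group coset coset_monoid_morphism.

Lemma coset_eq1 x : coset x = 1 <-> nsub N x.
Proof.
have coset1 : coset 1 = 1 by [].
rewrite -coset1; split=> [/esym/coset_eq|Nx]; first by rewrite invg1 mul1g.
by apply/esym/coset_eq; rewrite invg1 mul1g.
Qed.

End Quotient.

Section Automorphisms.
Context {G : groupType}.

Record aut := Automorphism {
  aut_fun :> G -> G;
  autM : {morph aut_fun : x y / x * y};
  aut_bij : bijective aut_fun }.

HB.instance Definition _ := gen_eqMixin aut.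
HB.instance Definition _ := gen_choiceMixin aut.

Lemma aut_eq (f g : aut) : f =1 g -> f = g.
Proof.
case: f g => [f fM fb] [g gM gb] /= /funext fg; subst g.
by congr Automorphism; apply: Prop_irrelevance.
Qed.

Definition aut_one : aut :=
  @Automorphism id (fun _ _ => erefl) (Bijective (fun=> erefl) (fun=> erefl)).

Lemma aut_mul_morph (f g : aut) : {morph (f \o g) : x y / x * y}.
Proof. by move=> x y; rewrite /= !autM. Qed.

(* Automorphisms compose as functions: (f * g) x = f (g x). *)
Definition aut_mul (f g : aut) : aut :=
  Automorphism (aut_mul_morph f g) (bij_comp (aut_bij f) (aut_bij g)).

Lemma aut_inv_subproof (f : aut) : exists g : aut, cancel f g /\ cancel g f.
Proof.
have [g fK gK] := aut_bij f.
have gM : {morph g : x y / x * y}.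
  by move=> x y; apply: (canLR fK); rewrite autM !gK.
by exists (Automorphism gM (Bijective gK fK)).
Qed.
Definition aut_inv (f : aut) : aut := projT1 (cid (aut_inv_subproof f)).
Lemma aut_invK (f : aut) : cancel f (aut_inv f).
Proof. exact: (projT2 (cid (aut_inv_subproof f))).1. Qed.
Lemma aut_Kinv (f : aut) : cancel (aut_inv f) f.
Proof. exact: (projT2 (cid (aut_inv_subproof f))).2. Qed.

Lemma aut_mulA : associative aut_mul. Proof. by move=> *; apply: aut_eq. Qed.
Lemma aut_mul1 : left_id aut_one aut_mul.
Proof. by move=> *; apply: aut_eq. Qed.
Lemma aut_mulr1 : right_id aut_one aut_mul.
Proof. by move=> *; apply: aut_eq. Qed.
Lemma aut_mulV : left_inverse aut_one aut_inv aut_mul.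
Proof. by move=> f; apply: aut_eq => x /=; rewrite aut_invK. Qed.
Lemma aut_mulrV : right_inverse aut_one aut_inv aut_mul.
Proof. by move=> f; apply: aut_eq => x /=; rewrite aut_Kinv. Qed.

HB.instance Definition _ := isGroup.Build aut
  aut_mulA aut_mul1 aut_mulr1 aut_mulV aut_mulrV.

Lemma autK (f : aut) : cancel f (f^-1)%g. Proof. exact: aut_invK. Qed.
Lemma autVK (f : aut) : cancel (f^-1)%g f. Proof. exact: aut_Kinv. Qed.

Lemma aut_monoid_morphism (f : aut) : monoid_morphism (f : G -> G).
Proof.
split; last exact: autM.
by apply: (@mulIg _ (f 1)); rewrite -autM !mul1g.
Qed.

HB.instance Definition _ (f : aut) :=
  isUMagmaMorphism.Build G G (f : G -> G) (aut_monoid_morphism f).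

Lemma inner_morph (g : G) : {morph (fun x => x ^ g^-1) : x y / x * y}.
Proof. by move=> x y; rewrite conjMg. Qed.

Lemma inner_bij (g : G) : bijective (fun x => x ^ g^-1).
Proof.
by exists (conjg^~ g) => x; rewrite -conjgM ?mulgV ?mulVg conjg1.
Qed.

Definition inner (g : G) : aut := Automorphism (inner_morph g) (inner_bij g).

Lemma innerM : {morph inner : g h / g * h}.
Proof. by move=> g h; apply: aut_eq => x; rewrite /= invgM conjgM. Qed.

Lemma inner_monoid_morphism : monoid_morphism inner.
Proof.
by split; [apply: aut_eq => x; rewrite /= invg1 conjg1|exact: innerM].
Qed.
HB.instance Definition _ := isUMagmaMorphism.Build G aut inner
  inner_monoid_morphism.

Lemma inner_subgroup : subgroup (range inner).
Proof.
apply/subgroupP; split=> [|_ _ [g _ <-] [h _ <-]|_ [g _ <-]].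
- by exists 1; rewrite // gmulf1.
- by exists (g * h); rewrite // gmulfM.
- by exists g^-1; rewrite // gmulfV.
Qed.

Lemma inner_normal : normal (range inner).
Proof.
move=> _ f [g _ <-]; exists (f^-1 g) => //; apply: aut_eq => x.
apply: (can_inj (autK f)) => /=.
rewrite [RHS](autVK f) gmulfJ gmulfV.
by congr (_ ^ _^-1); exact: (autVK f).
Qed.

Definition Inn : normalSubgroup aut :=
  NormalSubgroup inner_subgroup inner_normal.

Definition Out : groupType := quotient_group Inn.

Definition characteristic (A : set G) : Prop :=
  subgroup A /\ forall f : aut, f @` A = A.

End Automorphisms.

Arguments aut G : clear implicits.
Arguments Inn G : clear implicits.
Arguments Out G : clear implicits.

Definition ker (G H : groupType) (f : G -> H) : set G := f @^-1` [set 1].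

Record charQuotient (G : groupType) := CharQuotient {
  cq_group : groupType;
  cq_map :> UMagmaMorphism.type G cq_group;
  cq_surj : forall y, exists x, cq_map x = y;
  cq_char : characteristic (ker cq_map) }.

Section InducedOut.
Context {G : groupType} (q : charQuotient G).
Let Q := cq_group q.

Lemma cq_eq x y : q x = q y <-> ker q (x^-1 * y).
Proof.
rewrite /ker /= gmulfM gmulfV; split=> [->|qxy]; first by rewrite mulVg.
by rewrite -[RHS]mul1g -(mulgV (q x)) -mulgA qxy mulg1.
Qed.

Lemma cq_aut_compat (f : aut G) x y : q x = q y -> q (f x) = q (f y).
Proof.
move=> /cq_eq kxy; apply/cq_eq; rewrite -gmulfV -gmulfM.
by rewrite -((cq_char q).2 f); exists (x^-1 * y).
Qed.

Definition cq_section (y : Q) : G := projT1 (cid (cq_surj y)).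

Lemma cq_sectionK (y : Q) : q (cq_section y) = y.
Proof. exact: projT2 (cid (cq_surj y)). Qed.

Definition aut_push_fun (f : aut G) (y : Q) : Q := q (f (cq_section y)).

Lemma aut_push_funE (f : aut G) x : aut_push_fun f (q x) = q (f x).
Proof. by apply: cq_aut_compat; rewrite cq_sectionK. Qed.

Lemma aut_push_morph (f : aut G) : {morph aut_push_fun f : x y / x * y}.
Proof.
move=> u v; have [[x <-] [y <-]] := (cq_surj u, cq_surj v).
by rewrite -gmulfM !aut_push_funE !gmulfM.
Qed.

Lemma aut_push_bij (f : aut G) : bijective (aut_push_fun f).
Proof.
exists (aut_push_fun f^-1) => u; have [x <-] := cq_surj u;
  by rewrite !aut_push_funE ?autK ?autVK.
Qed.

(* The automorphism of Q induced by f, characterised by [aut_pushE]. *)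
Definition aut_push (f : aut G) : aut Q :=
  Automorphism (aut_push_morph f) (aut_push_bij f).

Lemma aut_pushE (f : aut G) x : aut_push f (q x) = q (f x).
Proof. exact: aut_push_funE. Qed.

Lemma aut_pushM : {morph aut_push : f g / f * g}.
Proof.
move=> f g; apply: aut_eq => u; have [x <-] := cq_surj u.
by rewrite /= !aut_push_funE.
Qed.

Lemma aut_push_monoid_morphism : monoid_morphism aut_push.
Proof.
split; last exact: aut_pushM.
by apply: aut_eq => u; have [x <-] := cq_surj u; rewrite aut_pushE.
Qed.

HB.instance Definition _ := isUMagmaMorphism.Build (aut G) (aut Q) aut_push
  aut_push_monoid_morphism.

Lemma aut_push_inner g : aut_push (inner g) = inner (q g).
Proof.
apply: aut_eq => u; have [x <-] := cq_surj u.
by rewrite aut_pushE /= gmulfJ gmulfV.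
Qed.

(* The map q_* : Out(G) -> Out(Q), characterised by [out_pushE]. *)
Definition out_push (u : Out G) : Out Q := coset (Inn Q) (aut_push (repr u)).

Lemma out_pushE (f : aut G) :
  out_push (coset (Inn G) f) = coset (Inn Q) (aut_push f).
Proof.
have /coset_eq[g _ gE] : coset (Inn G) (repr (coset (Inn G) f)) =
  coset (Inn G) f by rewrite /coset reprK.
apply/coset_eq; exists (q g) => //.
by rewrite -aut_push_inner gE gmulfM gmulfV.
Qed.

Lemma out_push_monoid_morphism : monoid_morphism out_push.
Proof.
split=> [|u v]; first by rewrite out_pushE gmulf1.
have [[f <-] [g <-]] := (coset_surj u, coset_surj v).
by rewrite -gmulfM !out_pushE !gmulfM.
Qed.

HB.instance Definition _ := isUMagmaMorphism.Build (Out G) (Out Q) out_push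
  out_push_monoid_morphism.

End InducedOut.

Definition congruence_subgroup (G L : groupType)
    (lambda : UMagmaMorphism.type L (Out G)) (K : set L) : Prop :=
  exists q : charQuotient G, finite_set [set: cq_group q] /\
  exists H : set (Out (cq_group q)),
    subgroup H /\ K = (out_push q \o lambda) @^-1` H.

Definition CSP (G L : groupType)
    (lambda : UMagmaMorphism.type L (Out G)) : Prop :=
  forall K : set L, subgroup K -> finite_index K -> ker lambda `<=` K ->
  congruence_subgroup lambda K.

Section Abelianisation.
Context (G : groupType).

Definition derived : set G := commutator setT setT.

Lemma derived_char : characteristic derived.
Proof.
split=> [|f]; first exact: generated_subgroup.
have sub (h : aut G) : derived `<=` h @^-1` derived.
  apply: smallest_sub => [|_ [x _ [y _ <-]]].
    have /subgroupP[D1 DM DV] := generated_subgroup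
      [set [~ x, y] | x in [set: G] & y in [set: G]].
    apply/subgroupP; split=> [|x y Dx Dy|x Dx] /=.
    + by rewrite gmulf1.
    + by rewrite gmulfM; apply: DM.
    + by rewrite gmulfV; apply: DV.
  by rewrite /preimage /= gmulfR; apply: sub_gen_smallest; exists (h x) => //;
    exists (h y).
apply/seteqP; split=> [_ [x Dx <-]|x Dx]; first exact: sub.
by exists (f^-1 x); [exact: sub|exact: autVK].
Qed.

Lemma derived_normal : normal derived.
Proof.
move=> x y Dx; rewrite -(derived_char.2 (inner y^-1)).
by exists x; rewrite //= invgK.
Qed.

Definition derived_nsub : normalSubgroup G :=
  NormalSubgroup derived_char.1 derived_normal.

Definition abelianisation : groupType := quotient_group derived_nsub.

Lemma ker_coset_derived : ker (coset derived_nsub) = derived.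
Proof. by apply/seteqP; split=> x; case: (coset_eq1 derived_nsub x). Qed.

Lemma abelianisation_char : characteristic (ker (coset derived_nsub)).
Proof. by rewrite ker_coset_derived; exact: derived_char. Qed.

Definition ab : charQuotient G :=
  @CharQuotient G abelianisation (coset derived_nsub)
    (@coset_surj G derived_nsub) abelianisation_char.

End Abelianisation.

(* Main.v *)
Require Import Defs.
From HB Require Import structures.
From mathcomp Require Import all_boot.
From mathcomp Require Import boolp classical_sets functions cardinality.

Set Implicit Arguments.
Unset Strict Implicit.
Unset Printing Implicit Defensive.

(** The proof takes place in the group of automorphisms. Write [A] for the
automorphisms whose outer class is in the image of [Lambda], and replace a
subgroup [K] of [Lambda] by its preimage in [A], which contains the inner
automorphisms. If an automorphism in [A] acts on a finite quotient [G / N] as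
an inner one, composing it with an inner automorphism of [G] makes it act
trivially there, without changing whether it belongs to the preimage of [K];
thus it is enough to find a finite characteristic quotient such that all
automorphisms in [A] acting trivially on it are in the preimage of [K]
([congruence_of_power_lift]). This quotient is taken to be [G / G^m] where
[G^m] is generated by the [m]-th powers; a finitely generated nilpotent
torsion group being finite, so is this one ([power_quotient_finite]).

Let [T_n] be the group of automorphisms acting trivially on the quotient by
[lower_central n], where [lower_central 1] is the derived subgroup. By
induction on [n > 0], every subgroup [K] of finite index in [A] that contains
the intersection of [A] and [T_n] also contains the automorphisms in [A] that
act trivially on some [G / G^m] ([power_congruence_induction]). For [n = 1] this
is the hypothesis on the abelianisation ([congruence_abelianisation]); for
[n] large [T_n] is trivial, and the theorem follows.

In the step from [n] to [n + 1], an automorphism [f] in [T_n] is determined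
modulo [T_(n+1)] by the displacements [x_i^-1 * f x_i] of generators [x_i],
taken modulo [lower_central (n+1)], and this family depends multiplicatively on
[f]. It lies in a central subgroup of the power [(G / lower_central (n+1))^I],
so the displacements of the elements of [K] in [T_n] form a normal subgroup [D]
of this power. The quotient by [D] is finitely generated and nilpotent, hence residually finite
([nilpotent_residually_finite]), and so the finitely many classes of [A] in
[T_n] outside of [K] can be separated from [D] by [m]-th powers: an element of
[A] in [T_n] acting trivially on [G / G^m] is in [K]
([congruence_central_step]). The elements of [K] acting trivially on [G / G^m]
form with [T_n] a subgroup of finite index, to which the induction hypothesis
applies; if it provides the exponent [m'], then [m * m'] suits [K].

Residual finiteness is proved with Zorn's lemma: if [N] is maximal among the
normal subgroups that do not contain [g], every nontrivial normal subgroup of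
[G / N] contains the image of [g]. This forces the centre of [G / N] to be
torsion ([monolith_center_torsion]), then [G / N] itself
([torsion_of_center]), and [G / N] is finite. *)

Local Open Scope classical_set_scope.
Local Open Scope group_scope.

(** * Subgroups and the lower central series *)

Section SubgroupTheory.
Context {G : groupType}.
Implicit Types (A B C : set G) (x y : G) (N : normalSubgroup G).

Lemma subgroup1 A : subgroup A -> A 1.
Proof. by case/subgroupP. Qed.

Lemma subgroupM A x y : subgroup A -> A x -> A y -> A (x * y).
Proof. by case/subgroupP=> _ + _; apply. Qed.

Lemma subgroupV A x : subgroup A -> A x -> A x^-1.
Proof. by case/subgroupP=> _ _; apply. Qed.

Lemma subgroupX A x n : subgroup A -> A x -> A (x ^+ n).
Proof.
move=> sA Ax; elim: n => [|n IHn]; first exact: subgroup1.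
by rewrite expgS; apply: subgroupM.
Qed.

Lemma subgroup_setT : subgroup [set: G].
Proof. exact/subgroupP. Qed.

Lemma subgroup_set1 : subgroup [set 1 : G].
Proof.
by apply/subgroupP; split=> [//|x y /= -> ->|x /= ->]; rewrite ?mul1g ?invg1.
Qed.

Lemma subgroup_setI A B : subgroup A -> subgroup B -> subgroup (A `&` B).
Proof.
move=> sA sB; apply/subgroupP; split=> [|x y [Ax Bx] [Ay By]|x [Ax Bx]].
- by split; apply: subgroup1.
- by split; apply: subgroupM.
- by split; apply: subgroupV.
Qed.

Lemma sub_generated A : A `<=` generated A.
Proof. exact: sub_gen_smallest. Qed.

Lemma generated_sub A B : subgroup B -> A `<=` B -> generated A `<=` B.
Proof. by move=> sB; apply: smallest_sub. Qed.

Lemma generatedS A B : A `<=` B -> generated A `<=` generated B.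
Proof.
move=> AB; apply: generated_sub; first exact: generated_subgroup.
exact: subset_trans AB (@sub_generated B).
Qed.

End SubgroupTheory.

Section SubgroupMorphisms.
Context {G : groupType}.
Implicit Types (A B : set G) (x y : G) (N : normalSubgroup G).

Lemma subgroup_preimage (H : groupType) (f : UMagmaMorphism.type G H)
  (B : set H) : subgroup B -> subgroup (f @^-1` B).
Proof.
move=> sB; apply/subgroupP; split=> [|x y Bx By|x Bx] /=.
- by rewrite gmulf1; exact: (subgroup1 sB).
- by rewrite gmulfM; exact: (subgroupM sB).
- by rewrite gmulfV; exact: (subgroupV sB).
Qed.

Lemma subgroup_image (H : groupType) (f : UMagmaMorphism.type G H) A :
  subgroup A -> subgroup (f @` A).
Proof.
move=> sA; apply/subgroupP; split=> [|_ _ [x Ax <-] [y Ay <-]|_ [x Ax <-]].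
- by exists 1; [apply: subgroup1|rewrite gmulf1].
- by exists (x * y); [apply: subgroupM|rewrite gmulfM].
- by exists x^-1; [apply: subgroupV|rewrite gmulfV].
Qed.

Lemma subgroup_equalizer (H : groupType) (f g : UMagmaMorphism.type G H) :
  subgroup [set x | f x = g x].
Proof.
apply/subgroupP; split=> [|x y /= fgx fgy|x /= fgx].
- by rewrite /= !gmulf1.
- by rewrite !gmulfM fgx fgy.
- by rewrite !gmulfV fgx.
Qed.

Lemma commg_mod N x y : nsub N [~ x, y] <-> commute (coset N x) (coset N y).
Proof. by rewrite -coset_eq1 gmulfR; split=> [/eqP/commgP|/commgP/eqP]. Qed.

(** This set is the preimage of the centraliser of [coset N y]. *)
Lemma subgroup_commg_mod N y : subgroup [set x | nsub N [~ x, y]].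
Proof.
apply/subgroupP; split=> [|x z /commg_mod xy /commg_mod zy|x /commg_mod xy];
  apply/commg_mod/commute_sym; rewrite ?gmulf1 ?gmulfM ?gmulfV.
- exact: commute1.
- by apply: commuteM; apply: commute_sym.
- by apply: commuteV; apply: commute_sym.
Qed.

Lemma commg_modC N x y : nsub N [~ x, y] -> nsub N [~ y, x].
Proof. by rewrite !commg_mod; apply: commute_sym. Qed.

Lemma characteristic_image A (f : aut G) x : characteristic A -> A x -> A (f x).
Proof. by case=> _ charA Ax; rewrite -(charA f); exists x. Qed.

Lemma characteristic_normal A : characteristic A -> normal A.
Proof.
move=> charA x y Ax; rewrite -[y]invgK.
exact: (characteristic_image (inner y^-1) charA Ax).
Qed.

(** It is enough to check that every automorphism maps [A] into itself, for
its inverse does so too. *)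
Lemma characteristicI A : subgroup A ->
  (forall (f : aut G) x, A x -> A (f x)) -> characteristic A.
Proof.
move=> sA fA; split=> // f; apply/seteqP; split=> [_ [x Ax <-]|x Ax].
  exact: fA.
by exists (f^-1 x); [exact: fA|exact: autVK].
Qed.

Definition characteristic_nsub A (charA : characteristic A) :=
  NormalSubgroup charA.1 (characteristic_normal charA).

End SubgroupMorphisms.

Section LowerCentral.

Lemma lower_central_subgroup (G : groupType) n :
  subgroup (@lower_central G n).
Proof.
by case: n => [|n]; [apply: subgroup_setT|apply: generated_subgroup].
Qed.

Lemma lower_central_commg (G : groupType) n (x y : G) :
  lower_central n x -> lower_central n.+1 [~ x, y].
Proof. by move=> nx; apply: sub_generated; exists x => //; exists y. Qed.

Lemma lower_central_min (G : groupType) n (B : set G) : subgroup B ->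
  (forall x y, lower_central n x -> B [~ x, y]) -> lower_central n.+1 `<=` B.
Proof.
by move=> sB BP; apply: generated_sub => // _ [x nx [y _ <-]]; apply: BP.
Qed.

Lemma lower_central_morph (G H : groupType) (f : UMagmaMorphism.type G H) n :
  lower_central n `<=` f @^-1` lower_central n.
Proof.
elim: n => [//|n IHn]; apply: lower_central_min.
  exact/subgroup_preimage/lower_central_subgroup.
by move=> x y /IHn nx; rewrite /= gmulfR; apply: lower_central_commg.
Qed.

Lemma lower_central_surj (G H : groupType) (f : UMagmaMorphism.type G H) n :
  (forall y, exists x, f x = y) -> lower_central n `<=` f @` lower_central n.
Proof.
move=> f_surj; elim: n => [y _|n IHn].
  by have [x <-] := f_surj y; exists x.
apply: lower_central_min; first exact/subgroup_image/lower_central_subgroup.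
move=> _ y /IHn[x nx <-]; have [z <-] := f_surj y.
by exists [~ x, z]; [apply: lower_central_commg|rewrite gmulfR].
Qed.

Lemma lower_central_char (G : groupType) n :
  characteristic (@lower_central G n).
Proof.
apply: characteristicI => [|f x]; first exact: lower_central_subgroup.
exact: lower_central_morph.
Qed.

Definition lower_central_nsub (G : groupType) n :=
  characteristic_nsub (lower_central_char G n).

Lemma lower_centralS (G : groupType) n :
  @lower_central G n.+1 `<=` lower_central n.
Proof.
have sn := lower_central_subgroup G n.
apply: lower_central_min => // x y nx; rewrite commgEl; apply: subgroupM => //.
  exact: subgroupV.
exact: (nsub_normal (n := lower_central_nsub G n)).
Qed.

Lemma lower_central_sub_derived (G : groupType) n :
  @lower_central G n.+1 `<=` @derived G.
Proof.
elim: n => // n IHn; apply: subset_trans IHn; exact: lower_centralS.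
Qed.

(** Between two consecutive terms of the series everything is normal, since
the quotient of these terms is central. *)
Lemma lower_central_between (G : groupType) n (B : set G) : subgroup B ->
  lower_central n.+1 `<=` B -> B `<=` lower_central n -> normal B.
Proof.
move=> sB nB Bn x y Bx; rewrite -[x ^ y](mulVKg x) -commgEl.
exact: (subgroupM sB Bx (nB _ (lower_central_commg y (Bn _ Bx)))).
Qed.

End LowerCentral.

Lemma nilpotent_surj (G H : groupType) (f : UMagmaMorphism.type G H) :
  (forall y, exists x, f x = y) -> nilpotent G -> nilpotent H.
Proof.
move=> f_surj [n n1]; exists n; apply/seteqP; split=> [y|_ ->].
  by move=> /(lower_central_surj f_surj)[x]; rewrite n1 => -> <-; apply: gmulf1.
exact: (subgroup1 (lower_central_subgroup H n)).
Qed.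

(** Stated as an induction principle, the form in which generation is used; in
particular it is inherited by quotients without describing their elements as
words. *)
Definition generating (G : groupType) (I : Type) (x : I -> G) : Prop :=
  forall A : set G, subgroup A -> (forall i, A (x i)) -> forall y, A y.

Lemma finitely_generatedP (G : groupType) : finitely_generated G ->
  exists (I : finType) (x : I -> G), generating x.
Proof.
case=> A /finite_seqP[s ->] sG.
exists 'I_(size s), (fun i : 'I__ => nth 1 s i) => B sB sBP y.
suff /(_ y) : [set: G] `<=` B by apply.
rewrite -sG; apply: generated_sub => // z /= /(nthP 1)[i i_s <-].
exact: (sBP (Ordinal i_s)).
Qed.

Lemma generating_surj (G H : groupType) (f : UMagmaMorphism.type G H)
    (I : Type) (x : I -> G) :
  (forall y, exists x, f x = y) -> generating x -> generating (f \o x).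
Proof.
move=> f_surj xG A sA xA y; have [z <-] := f_surj y.
exact: (xG _ (subgroup_preimage f sA)).
Qed.

(** * Torsion in nilpotent groups *)

(** The product of individual exponents is a common one. *)
Lemma common_multiple (T : eqType) (s : seq T) (P : T -> nat -> Prop) :
  (forall t m k, 0 < k -> P t m -> P t (m * k)%N) ->
  (forall t, t \in s -> exists2 m, 0 < m & P t m) ->
  exists2 m, 0 < m & forall t, t \in s -> P t m.
Proof.
move=> PM; elim: s => [|t s IHs] Ps; first by exists 1%N.
have [|m m0 Pm] := IHs; first by move=> u us; apply: Ps; rewrite inE us orbT.
have [k k0 Pk] := Ps t (mem_head t s).
exists (m * k)%N; first by rewrite muln_gt0 m0.
move=> u; rewrite inE => /predU1P[->|us]; last exact/PM/Pm.
by rewrite mulnC; apply: PM.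
Qed.

Definition torsion (G : groupType) : Prop :=
  forall x : G, exists2 n, 0 < n & x ^+ n = 1.

(** The factors of [x ^ y = x * [~ x, y]] commute, so that its powers are the
products of theirs. *)
Lemma commXg (G : groupType) (x y : G) n :
  commute x [~ x, y] -> [~ x ^+ n, y] = [~ x, y] ^+ n.
Proof.
by move=> cx; rewrite commgEl conjXg -[x ^ y](mulVKg x) -commgEl expgMn ?mulKg.
Qed.

Lemma expg_mod_torsion (G : groupType) (x : G) n k :
  x ^+ n = 1 -> x ^+ k = x ^+ (k %% n).
Proof.
by move=> xn; rewrite {1}(divn_eq k n) expgnDr mulnC expgnA xn expg1n mul1g.
Qed.

Lemma finite_torsion_exponent (G : groupType) :
  finite_set [set: G] -> torsion G ->
  exists2 m, 0 < m & forall x : G, x ^+ m = 1.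
Proof.
case/finite_seqP=> s sG torG.
have [|x _|m m0 sm] := @common_multiple G s (fun x m => x ^+ m = 1).
- by move=> x m k _ xm; rewrite expgnA xm expg1n.
- exact: torG.
exists m => // x; apply: sm.
by have : [set: G] x by []; rewrite sG.
Qed.

Section FiniteIndexStep.
Variables (G : groupType) (B : set G) (x : G) (k : nat).
Hypotheses (sB : subgroup B) (nB : normal B) (k0 : 0 < k) (xk : x ^+ k = 1).

Let XB : set G := [set y | exists a, exists2 b, B b & y = x ^+ a * b].

(** As [x] normalises [B], the subgroup generated by [x] and [B] consists of the
products [x ^+ a * b], and [a] only matters modulo [k]. *)
Lemma finite_adjoin :
  finite_set B -> finite_set (generated (x |` B)).
Proof.
move=> finB.
have sXB : subgroup XB.
  apply/subgroupP;
    split=> [|_ _ [a [b Bb ->]] [a' [b' Bb' ->]]|_ [a [b Bb ->]]].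
  - by exists 0%N, 1; [apply: subgroup1|rewrite mulg1].
  - exists (a + a'), (b ^ (x ^+ a') * b').
      by apply: subgroupM => //; apply: nB.
    by rewrite expgnDr !mulgA; congr (_ * _); rewrite -!mulgA -conjgC.
  - exists (a * k.-1)%N, (b^-1 ^ (x ^+ (a * k.-1)%N)).
      exact: nB (subgroupV sB Bb).
    rewrite -conjgC invgM; congr (_ * _); apply: mulg1_eq.
    by rewrite -expgnDr -mulnS prednK // mulnC expgnA xk expg1n.
have : generated (x |` B) `<=`
    [set x ^+ val a * b | a in [set: 'I_k] & b in B].
  apply: (@subset_trans _ XB).
    apply: generated_sub => // y [->|By].
      by exists 1%N, 1; [apply: subgroup1|rewrite mulg1].
    by exists 0, y; rewrite ?mul1g.
  move=> _ [a [b Bb ->]]; exists (Ordinal (ltn_pmod a k0)) => //.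
  by exists b => //=; rewrite -expg_mod_torsion.
by move/sub_finite_set; apply; apply: finite_image2.
Qed.

End FiniteIndexStep.

(** Modulo the next term, a term of the lower central series is generated by
the commutators of generators of the previous term with those of [G],
commutators being bilinear there. *)
Lemma lower_central_generating (G : groupType) (I : finType) (x : I -> G) n :
  generating x -> exists s : seq G, {in s, forall y, lower_central n y} /\
    lower_central n `<=` generated ([set` s] `|` lower_central n.+1).
Proof.
move=> xG; elim: n => [|n [s [sn ns]]].
  exists (codom x); split=> // y _; apply: (xG _ (generated_subgroup _)) => i.
  by apply: sub_generated; left; rewrite /= codom_f.
exists [seq [~ y, x i] | y <- s, i <- enum I].
set B := generated _; have sB : subgroup B by apply: generated_subgroup.
have ssn y : y \in [seq [~ y, x i] | y <- s, i <- enum I] ->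
    lower_central n.+1 y.
  by case/allpairsP=> -[z i] /= [zs _ ->]; exact: lower_central_commg (sn _ zs).
split=> //; have nB : normal B.
  apply: (@lower_central_between _ n.+1) => //.
    by move=> y ny; apply: sub_generated; right.
  apply: generated_sub => [|y [/ssn//|]]; first exact: lower_central_subgroup.
  exact: lower_centralS.
pose N := NormalSubgroup sB nB.
apply: lower_central_min => // y z ny.
suff : nsub N [~ z, y] by apply: commg_modC.
move: z; apply: (xG _ (subgroup_commg_mod N y)) => i /=.
apply: (@commg_modC _ N).
have sNi := subgroup_commg_mod N (x i).
suff : lower_central n `<=` [set y | nsub N [~ y, x i]] by apply.
apply: subset_trans ns _; apply: generated_sub => // w [ws|nw].
  apply: sub_generated; left; apply/allpairsP.
  by exists (w, i); rewrite mem_enum.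
apply: sub_generated; right; exact: lower_central_commg.
Qed.

(** Going up the lower central series from its trivial term, each term is
obtained from the next one by adjoining finitely many elements, each of which
has finite order and normalises what precedes it. *)
Lemma torsion_nilpotent_finite (G : groupType) (I : finType) (x : I -> G) :
  generating x -> nilpotent G -> torsion G -> finite_set [set: G].
Proof.
move=> xG [c c1] torG.
suff fin n : n <= c -> finite_set (@lower_central G (c - n)).
  by have := fin c (leqnn c); rewrite subnn.
elim: n => [_|n IHn nc]; first by rewrite subn0 c1; apply: finite_set1.
have [s [sn ns]] := lower_central_generating (c - n.+1) xG.
apply: sub_finite_set ns _.
have {IHn} : finite_set (@lower_central G (c - n.+1).+1).
  by rewrite subnSK //; apply/IHn/ltnW.
move: (c - n.+1)%N sn => {nc}n sn finn.
elim: s sn => [|y s IHs] sn.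
  rewrite set_nil set0U; suff -> : generated (lower_central n.+1) =
    @lower_central G n.+1 by [].
  exact/smallest_id/lower_central_subgroup.
have {IHs} finB : finite_set (generated ([set` s] `|` @lower_central G n.+1)).
  by apply: IHs => z zs; apply: sn; rewrite inE zs orbT.
set B := generated _ in finB; have sB : subgroup B by apply: generated_subgroup.
have nB : normal B.
  apply: (@lower_central_between _ n) => // [z nz|].
    by apply: sub_generated; right.
  apply: generated_sub; first exact: lower_central_subgroup.
  by move=> z [zs|/lower_centralS//]; apply: sn; rewrite inE zs orbT.
have [k k0 yk] := torG y.
apply: sub_finite_set (finite_adjoin sB nB k0 yk finB); apply: generatedS.
move=> z [|nz]; last by right; apply: sub_generated; right.
rewrite /= inE => /predU1P[->|zs]; first by left.
by right; apply: sub_generated; left.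
Qed.

(** The upper central series is the one along which torsion spreads from the
centre to the whole group. *)
Fixpoint upper_central (G : groupType) (n : nat) : set G :=
  if n is m.+1 then [set x | forall y, upper_central m [~ x, y]] else [set 1].

Lemma upper_central_char (G : groupType) n :
  characteristic (@upper_central G n).
Proof.
elim: n => [|n chn].
  apply: characteristicI => [|f x ->]; first exact: subgroup_set1.
  exact: gmulf1.
pose N := characteristic_nsub chn.
apply: characteristicI => [|f x nx y].
  suff -> : @upper_central G n.+1 = \bigcap_y [set x | nsub N [~ x, y]].
    apply/subgroupP; split=> [y _|x z nx nz y _|x nx y _] /=.
    - exact: (subgroup1 (subgroup_commg_mod N y)).
    - exact: (subgroupM (subgroup_commg_mod N y) (nx y I) (nz y I)).
    - exact: (subgroupV (subgroup_commg_mod N y) (nx y I)).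
  by apply/seteqP; split=> x nx y; [move=> _|]; apply: nx.
rewrite -[y](autVK f) -gmulfR; exact: characteristic_image chn (nx _).
Qed.

Definition upper_central_nsub (G : groupType) n :=
  characteristic_nsub (@upper_central_char G n).

Lemma lower_sub_upper_central (G : groupType) c n :
  @lower_central G c = [set 1] -> n <= c ->
  @lower_central G (c - n) `<=` upper_central n.
Proof.
move=> c1; elim: n => [_|n IHn nc x nx y]; first by rewrite subn0 c1.
apply: (IHn (ltnW nc)); rewrite -subnSK //; exact: lower_central_commg.
Qed.

(** If the centre of [G / N] is torsion, so is the centre of its quotient by
this centre: [ [~ z ^+ m, x] ] is the [m]-th power of the central [ [~ z, x] ],
so it vanishes for a suitable [m], the same for all [x] in a finite
generating family. *)
Lemma upper_central_torsion_step (G : groupType) (I : finType) (x : I -> G)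
    (N : normalSubgroup G) : generating x ->
  (forall z, (forall y, nsub N [~ z, y]) ->
    exists2 k, 0 < k & nsub N (z ^+ k)) ->
  forall z, (forall y t, nsub N [~ [~ z, y], t]) ->
    exists2 k, 0 < k & forall y, nsub N [~ z ^+ k, y].
Proof.
move=> xG torN z zN.
have powN i k : nsub N [~ z ^+ k, x i] <-> nsub N ([~ z, x i] ^+ k).
  rewrite -!coset_eq1 gmulfR !gmulfXn gmulfR commXg //.
  by rewrite -gmulfR; apply/commute_sym/commg_mod.
have [|i _|k k0 kP] := @common_multiple _ (enum I)
    (fun i k => nsub N [~ z ^+ k, x i]).
- move=> i k l _ /powN Nk; apply/powN; rewrite expgnA.
  exact: subgroupX (nsub_subgroup N) Nk.
- have [k k0 Nk] := torN _ (zN (x i)); exists k => //; exact/powN.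
exists k => // y; apply: commg_modC; move: y.
apply: (xG _ (subgroup_commg_mod N (z ^+ k))) => i.
by apply: commg_modC; apply: kP; rewrite mem_enum.
Qed.

Lemma torsion_of_center (G : groupType) (I : finType) (x : I -> G) :
  generating x -> nilpotent G ->
  (forall z : G, (forall y, [~ z, y] = 1) -> exists2 k, 0 < k & z ^+ k = 1) ->
  torsion G.
Proof.
move=> xG [c c1] torZ.
have step n (z : G) : upper_central n.+1 z ->
    exists2 k, 0 < k & upper_central n (z ^+ k).
  elim: n z => [|n IHn] z nz; first by have [k] := torZ z nz; exists k.
  have torN :=
    @upper_central_torsion_step G I x (upper_central_nsub G n) xG IHn.
  by apply: torN => y t; apply: nz.
have tor n (z : G) : upper_central n z -> exists2 k, 0 < k & z ^+ k = 1.
  elim: n z => [|n IHn] z; first by move=> ->; exists 1%N.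
  case/step=> k k0 /IHn[l l0 zl]; exists (k * l)%N.
    by rewrite muln_gt0 k0.
  by rewrite expgnA.
move=> z; apply: (tor c); apply: (lower_sub_upper_central c1) => //.
by rewrite subnn.
Qed.

(** * Residual finiteness of finitely generated nilpotent groups *)

(** Power subgroups stand for subgroups of finite index: they are
characteristic, respected by all morphisms, and any two contain a third one. *)
Definition power_subgroup (G : groupType) (m : nat) : set G :=
  generated (range (fun x : G => x ^+ m)).

Lemma power_subgroup_sub (G : groupType) m (B : set G) : subgroup B ->
  (forall x, B (x ^+ m)) -> power_subgroup m `<=` B.
Proof. by move=> sB BX; apply: generated_sub => // _ [x _ <-]. Qed.

Lemma power_subgroupX (G : groupType) m (x : G) : power_subgroup m (x ^+ m).
Proof. by apply: sub_generated; exists x. Qed.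

Lemma power_subgroup_morph (G H : groupType) (f : UMagmaMorphism.type G H) m :
  power_subgroup m `<=` f @^-1` power_subgroup m.
Proof.
apply: power_subgroup_sub => [|x].
  exact: subgroup_preimage (generated_subgroup _).
by rewrite /preimage /= gmulfXn; apply: power_subgroupX.
Qed.

Lemma power_subgroup_char (G : groupType) m :
  characteristic (@power_subgroup G m).
Proof.
apply: characteristicI => [|f x]; first exact: generated_subgroup.
exact: power_subgroup_morph.
Qed.

Definition power_nsub (G : groupType) m :=
  characteristic_nsub (@power_subgroup_char G m).

Lemma power_subgroupM (G : groupType) m k :
  @power_subgroup G (m * k) `<=` power_subgroup m.
Proof.
apply: power_subgroup_sub => [|x]; first exact: generated_subgroup.
by rewrite mulnC expgnA; apply: power_subgroupX.
Qed.

Lemma power_quotient_finite (G : groupType) (I : finType) (x : I -> G) m :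
  generating x -> nilpotent G -> 0 < m ->
  finite_set [set: quotient_group (power_nsub G m)].
Proof.
move=> xG nilG m0; set Q := quotient_group _.
have Qs : forall u : Q, exists x, coset _ x = u by apply: coset_surj.
apply: (torsion_nilpotent_finite (generating_surj Qs xG)).
  exact: nilpotent_surj Qs nilG.
move=> u; have [y <-] := Qs u; exists m => //; rewrite -gmulfXn.
by apply/(coset_eq1 (power_nsub G m)); apply: power_subgroupX.
Qed.

Lemma maximal_normal_avoiding (G : groupType) (g : G) : g <> 1 ->
  exists N : normalSubgroup G, ~ nsub N g /\
    forall B, subgroup B -> normal B -> nsub N `<=` B -> ~ B g -> B `<=` nsub N.
Proof.
move=> g1.
(* The union of the empty chain is empty, so [set0] has to be admitted. *)
pose P (X : set G) := X = set0 \/ [/\ subgroup X, normal X & ~ X g].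
have P1 : P [set 1].
  right; split=> [||/= //]; first exact: subgroup_set1.
  by move=> x y /= ->; rewrite conj1g.
have [|X [PX maxX]] := @Zorn_bigcup G P.
  move=> F FP totF; have [F0|] := pselect (F `<=` [set set0]).
    by left; apply/seteqP; split=> // x [X /F0 -> []].
  case/existsNP=> X0 /not_implyP[FX0 X00].
  have FG X : F X -> X <> set0 -> [/\ subgroup X, normal X & ~ X g].
    by move=> /FP[].
  have memF X x : F X -> X x -> [/\ subgroup X, normal X & ~ X g].
    by move=> FX Xx; apply: FG => // X_0; rewrite X_0 in Xx.
  right; split=> [|x y [X FX Xx]|[X FX Xg]].
  - apply/subgroupP; split=> [|x y [X FX Xx] [Y FY Yy]|x [X FX Xx]].
    + by exists X0 => //; have [/subgroup1] := FG _ FX0 X00.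
    + have [XY|YX] := totF _ _ FX FY.
        exists Y => //; have [sY _ _] := memF _ _ FY Yy.
        exact: subgroupM sY (XY _ Xx) Yy.
      exists X => //; have [sX _ _] := memF _ _ FX Xx.
      exact: subgroupM sX Xx (YX _ Yy).
    + by exists X => //; have [sX _ _] := memF _ _ FX Xx; apply: subgroupV.
  - by exists X => //; have [_ nX _] := memF _ _ FX Xx; apply: nX.
  - by have [_ _] := memF _ _ FX Xg.
have [X0|[sX nX Xg]] := PX.
  by case: (maxX [set 1]) => //; split=> [|/(_ 1 erefl)]; rewrite X0.
exists (NormalSubgroup sX nX); split=> // B sB nB XB Bg; apply: contrapT => BX.
by apply: (maxX B) => //; right.
Qed.

(** A central element [z] of infinite order generates normal subgroups
[<[z ^+ m]>] for [m > 0], and no element other than [1] is in all of them. *)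
Lemma monolith_center_torsion (G : groupType) (g : G) : g <> 1 ->
  (forall B, subgroup B -> normal B -> ~ B g -> B `<=` [set 1]) ->
  forall z : G, (forall y, [~ z, y] = 1) -> exists2 k, 0 < k & z ^+ k = 1.
Proof.
move=> g1 mono z zC; apply: contrapT => ntor.
have zc y : commute z y by apply/commgP/eqP/zC.
have zX k : 0 < k -> z ^+ k <> 1 by move=> k0 zk; apply: ntor; exists k.
have zI a b : z ^+ a = z ^+ b -> a = b.
  wlog ab : a b / a <= b => [hw zab|zab].
    by case: (leqP a b) => [|/ltnW] ab; [apply: hw|apply/esym/hw].
  apply/eqP; rewrite eqn_leq ab leqNgt /=; apply/negP => lt_ab.
  apply: (zX (b - a)%N); first by rewrite subn_gt0.
  by rewrite expgnFr // zab mulgV.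
(* The cyclic subgroup [<[z ^+ m]>], its integer exponents being written as
differences [a - b] of natural numbers. *)
pose B m : set G := [set y | exists a b, y * z ^+ (m * b) = z ^+ (m * a)].
have sB m : subgroup (B m).
  apply/subgroupP; split=> [|y t [a [b yab]] [a' [b' tab]]|y [a [b yab]]].
  - by exists 0%N, 0%N; rewrite mul1g.
  - exists (a + a')%N, (b + b')%N.
    rewrite !mulnDr !expgnDr -yab -tab -!mulgA; congr (_ * _).
    rewrite !mulgA; congr (_ * _); exact/commuteX/commute_sym/zc.
  - exists b, a; rewrite -yab mulKg //.
have nB m : normal (B m).
  move=> y t [a [b yab]]; exists a, b; rewrite -[RHS](mulKg t).
  have zt k : z ^+ k = (z ^+ k) ^ t.
    by rewrite conjgE -(commuteX _ (commute_sym (zc t))) mulKg.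
  by rewrite mulKg zt -conjMg yab -zt.
have Bg m : 0 < m -> B m g.
  move=> m0; apply: contrapT => Bmg; apply: (zX m m0).
  apply: (mono _ (sB m) (nB m) Bmg); exists 1%N, 0%N.
  by rewrite muln0 muln1 mulg1.
(* If [g = z ^ (a - b)] is a power of [z ^+ m], then [m] divides [a - b]. The
choice of [m] larger than [a] and [b] leaves [a = b]. *)
have [a [b]] := Bg 1%N isT; rewrite !mul1n => gab.
have [//|a' [b']] := Bg (a + b).+1.
set m := (a + b).+1 => gab'.
have : z ^+ (a + m * b') = z ^+ (m * a' + b).
  rewrite expgnDr -gab -mulgA -expgnDr [(b + _)%N]addnC expgnDr mulgA gab'.
  by rewrite -expgnDr.
move/zI => eq_ab; apply: g1.
have := congr1 (modn^~ m) eq_ab.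
rewrite /= addnC ![(m * _)%N]mulnC !modnMDl.
rewrite !modn_small ?ltnS ?leq_addr ?leq_addl //.
by move=> eab; apply: (mulIg (z ^+ b)); rewrite gab eab mul1g.
Qed.

(** In the quotient by a normal subgroup [N] that is maximal among those
avoiding [g], all nontrivial normal subgroups contain the class of [g]. Hence
the centre of this quotient is torsion, and the quotient is finite; its exponent
is the required [m]. *)
Theorem nilpotent_residually_finite (G : groupType) (I : finType) (x : I -> G)
    (g : G) : generating x -> nilpotent G -> g <> 1 ->
  exists2 m, 0 < m & ~ power_subgroup m g.
Proof.
move=> xG nilG /maximal_normal_avoiding[N [Ng maxN]].
pose Q : groupType := quotient_group N.
have Qs : forall u : Q, exists x, coset N x = u by apply: coset_surj.
have xQ := generating_surj Qs xG; have nilQ := nilpotent_surj Qs nilG.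
have torQ : torsion Q.
  apply: (torsion_of_center xQ nilQ).
  apply: (@monolith_center_torsion _ (coset N g)).
    by move/coset_eq1.
  move=> B sB nB Bg u; have [y <-] := Qs u => By; apply/coset_eq1.
  apply: (maxN (coset N @^-1` B)) => //.
  - exact: subgroup_preimage sB.
  - by move=> z t Bz; rewrite /preimage /= gmulfJ; apply: nB.
  - by move=> z /coset_eq1; rewrite /preimage /= => ->; apply: subgroup1.
have [m m0 mQ] := finite_torsion_exponent
  (torsion_nilpotent_finite xQ nilQ torQ) torQ.
exists m => // mg; apply: Ng; move: mg.
apply: power_subgroup_sub => [|y]; first exact: nsub_subgroup.
by apply/coset_eq1; rewrite gmulfXn; apply: mQ.
Qed.

(** * Finite powers of a group *)

Section FinitePower.
Variables (G : groupType) (I : finType).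
Local Notation GI := {ffun I -> G}.

Definition ffun_single (i : I) (x : G) : GI :=
  [ffun j => if j == i then x else 1].

Lemma ffun_single_monoid_morphism i : monoid_morphism (ffun_single i).
Proof.
split=> [|x y]; apply/ffunP=> j; rewrite !ffunE; first by case: ifP.
by case: ifP; rewrite ?mul1g.
Qed.

HB.instance Definition _ i := isUMagmaMorphism.Build G GI
  (ffun_single i) (ffun_single_monoid_morphism i).

Definition ffun_eval (i : I) (v : GI) : G := v i.

Lemma ffun_eval_monoid_morphism i : monoid_morphism (ffun_eval i).
Proof. by split=> [|v w]; rewrite /ffun_eval ffunE. Qed.

HB.instance Definition _ i := isUMagmaMorphism.Build GI G
  (ffun_eval i) (ffun_eval_monoid_morphism i).

(** A family is the product of its one-coordinate parts. *)
Lemma subgroup_ffun (B : set GI) (v : GI) : subgroup B ->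
  (forall i, B (ffun_single i (v i))) -> B v.
Proof.
move=> sB Bv; suff Bs (s : seq I) : B [ffun j => if j \in s then v j else 1].
  suff <- : [ffun j => if j \in enum I then v j else 1] = v by [].
  by apply/ffunP=> j; rewrite ffunE mem_enum.
elim: s => [|i s IHs].
  rewrite (_ : finfun _ = 1); first exact: subgroup1.
  by apply/ffunP=> j; rewrite !ffunE.
have [i_s|i_s] := boolP (i \in s).
  rewrite (_ : finfun _ = [ffun j => if j \in s then v j else 1]) //.
  by apply/ffunP=> j; rewrite !ffunE inE; case: eqP => // ->; rewrite i_s.
rewrite (_ : finfun _ =
  ffun_single i (v i) * [ffun j => if j \in s then v j else 1]).
  exact: subgroupM.
apply/ffunP=> j; rewrite !ffunE inE.
case: eqP => [->|_] /=; last by rewrite mul1g.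
by rewrite (negPf i_s) mulg1.
Qed.

Lemma generating_ffun (J : finType) (x : J -> G) :
  generating x -> generating (fun p : I * J => ffun_single p.1 (x p.2)).
Proof.
move=> xG B sB Bx v; apply: subgroup_ffun => // i; move: (v i).
apply: (xG _ (subgroup_preimage (ffun_single i) sB)) => j.
exact: (Bx (i, j)).
Qed.

Lemma nilpotent_ffun : nilpotent G -> nilpotent GI.
Proof.
case=> c c1; exists c; apply/seteqP; split=> [v cv|_ ->]; last first.
  exact: subgroup1 (lower_central_subgroup _ _).
apply/ffunP=> i; rewrite ffunE.
have := @lower_central_morph _ _ (ffun_eval i) _ _ cv.
by rewrite /preimage /= c1.
Qed.

End FinitePower.

(** * Automorphisms acting trivially on a quotient *)

Definition trivial_mod (G : groupType) (N : set G) : set (aut G) :=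
  [set f | forall x, N (x^-1 * f x)].

Lemma trivial_modS (G : groupType) (N M : set G) :
  N `<=` M -> trivial_mod N `<=` trivial_mod M.
Proof. by move=> NM f Nf x; apply: NM. Qed.

Section TrivialMod.
Variables (G : groupType) (N : set G).
Hypothesis charN : characteristic N.

Lemma trivial_mod_subgroup : subgroup (trivial_mod N).
Proof.
have sN := charN.1.
apply/subgroupP; split=> [x|f g Nf Ng x|f Nf x].
- by rewrite mulVg; apply: subgroup1.
- rewrite -(mulgK (f x) x^-1) -mulgA; apply: (subgroupM sN (Nf x)).
  by rewrite -gmulfV -gmulfM; apply: characteristic_image (Ng x).
- rewrite -{1}(autK f x) -gmulfV -gmulfM; apply: characteristic_image => //.
  by rewrite -[x in _ * x]invgK -invgM; apply: subgroupV.
Qed.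

Lemma trivial_mod_normal : normal (trivial_mod N).
Proof.
move=> f g Nf x; rewrite -{1}(autK g x) -gmulfV -gmulfM.
exact: characteristic_image (Nf (g x)).
Qed.

(** Two automorphisms that agree modulo [N] on generators agree modulo [N]
everywhere, the set where they agree being a subgroup. *)
Lemma trivial_mod_generating (I : Type) (x : I -> G) (f g : aut G) :
  generating x -> (forall i, N ((f (x i))^-1 * g (x i))) ->
  trivial_mod N (f^-1 * g).
Proof.
move=> xG Nfg; pose M := characteristic_nsub charN.
have : forall y, coset M (f y) = coset M (g y).
  apply: (xG _ (subgroup_equalizer (coset M \o f) (coset M \o g))) => i.
  by apply/(coset_eq M); apply: Nfg.
move=> fg y; rewrite -{1}(autK f y) -gmulfV -gmulfM.
by apply: characteristic_image => //; apply/(coset_eq M).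
Qed.

End TrivialMod.

(** Central factors disappear from commutators. *)
Lemma commg_central (G : groupType) (a b d e : G) :
  (forall c, commute d c) -> (forall c, commute e c) ->
  [~ a * d, b * e] = [~ a, b].
Proof.
move=> dC eC; rewrite commgEl conjgM conjMg.
have Je c : c ^ e = c by rewrite conjgE -(eC c) mulKg.
have Jd c : d ^ c = d by rewrite conjgE dC mulKg.
by rewrite Je Jd invgM -mulgA [_ * (_ * d)]mulgA -dC mulKg.
Qed.

Section LowerCentralAction.
Variables (G : groupType) (n : nat).
Let N := lower_central_nsub G n.+1.

Lemma coset_lower_central_commute z y :
  lower_central n z -> commute (coset N z) (coset N y).
Proof.
by move=> nz; apply/(commg_mod N); exact: (lower_central_commg y nz).
Qed.

(** [x^-1 * f x] is central modulo [N], so that it disappears from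
commutators. *)
Lemma trivial_mod_derived (f : aut G) z :
  trivial_mod (lower_central n) f -> derived z -> coset N z = coset N (f z).
Proof.
move=> nf; move: z.
suff : @derived G `<=` [set z | coset N z = (coset N \o f) z].
  by [].
apply: (@lower_central_min _ 0); first exact: subgroup_equalizer.
move=> y t _ /=; have -> : f [~ y, t] = [~ f y, f t] by exact: gmulfR.
rewrite -[f y](mulVKg y) -[f t](mulVKg t) !(gmulfR (coset N)).
have := (nf y, nf t); move: (y^-1 * f y) (t^-1 * f t) => d e [nd ne].
by rewrite (gmulfM y d) (gmulfM t e) commg_central // => u;
  have [s <-] := coset_surj u; apply: coset_lower_central_commute.
Qed.

End LowerCentralAction.

(** * The displacement of generators *)

Section Displacement.
Variables (G : groupType) (I : finType) (x : I -> G) (n : nat).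

Local Notation GI := {ffun I -> G}.
Local Notation T := (trivial_mod (@lower_central G n.+1)).
Let N := lower_central_nsub G n.+2.

(** On [T] the displacement is a homomorphism modulo [N]. If [x] is generating,
its kernel consists of the automorphisms trivial modulo [N], by
[trivial_mod_generating]. *)
Definition displacement (f : aut G) : GI := [ffun i => (x i)^-1 * f (x i)].

Lemma displacement_lower f i : T f -> lower_central n.+1 (displacement f i).
Proof. by move=> Tf; rewrite ffunE; apply: Tf. Qed.

(** This is where starting from the abelianisation matters: as [n.+1 > 0], the
displacements lie in the derived subgroup, on which [T] acts trivially modulo
[N]. *)
Lemma coset_trivial_mod (f : aut G) z :
  T f -> lower_central n.+1 z -> coset N z = coset N (f z).
Proof.
move=> Tf nz; apply: trivial_mod_derived => //.
exact: lower_central_sub_derived nz.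
Qed.

Lemma displacementM (f g : aut G) i : T f -> T g ->
  coset N (displacement (f * g) i) =
  coset N (displacement f i) * coset N (displacement g i).
Proof.
move=> Tf Tg; rewrite (coset_trivial_mod Tf (displacement_lower i Tg)) -gmulfM.
rewrite !ffunE; have -> : f ((x i)^-1 * g (x i)) = (f (x i))^-1 * f (g (x i)).
  by rewrite -gmulfV -gmulfM.
by rewrite mulgA mulgK.
Qed.

Variable W : set (aut G).
Hypotheses (sW : subgroup W) (WT : W `<=` T).

Definition displacements : set GI :=
  [set v | exists2 w, W w &
     forall i, coset N (v i) = coset N (displacement w i)].

Lemma displacements_subgroup : subgroup displacements.
Proof.
apply/subgroupP; split=> [|v v' [w Ww vw] [w' Ww' vw']|v [w Ww vw]].
- exists 1; first exact: subgroup1.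
  by move=> i; rewrite !ffunE mulVg.
- exists (w * w'); first exact: subgroupM.
  move=> i; rewrite ffunE gmulfM /= vw vw'.
  by rewrite (displacementM i (WT Ww) (WT Ww')).
- have WwV := subgroupV sW Ww; exists w^-1 => // i.
  apply: (mulgI (coset N (v i))); rewrite {2}vw.
  rewrite -(displacementM i (WT Ww) (WT WwV)).
  by rewrite -gmulfM !ffunE !mulgV mulVg.
Qed.

Lemma displacements_normal : normal displacements.
Proof.
move=> v u [w Ww vw]; exists w => // i; rewrite !ffunE gmulfM gmulfV gmulfM.
rewrite /= vw; set d := displacement w i.
have -> : coset N d * coset N (u i) = coset N (u i) * coset N d.
  apply: coset_lower_central_commute; apply: displacement_lower; exact: WT.
by rewrite mulKg /d ffunE.
Qed.

Definition displacements_nsub :=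
  NormalSubgroup displacements_subgroup displacements_normal.

End Displacement.

(** Index is expressed by a colouring of [A] with finitely many colours that
separates the [K]-cosets. This form passes to subsets of [A], and products of
colourings take care of intersections; no choice of representatives is
involved. *)
Definition finite_index_in (G : groupType) (A K : set G) : Prop :=
  exists (T : finType) (c : G -> T),
    forall x y, A x -> A y -> c x = c y -> K (x^-1 * y).

(** A colour [t] either has only elements of [K] in [TG], and then any exponent
will do, or it has some [f0] in [TG] outside of [K]. The displacement of [f0] is
then nontrivial modulo those of [K], and remains so modulo [m]-th powers for a
suitable [m]. An [f] in [TG] of the same colour has the same displacement as
[f0] modulo those of [K], so it cannot be trivial modulo [m]-th powers. *)
Lemma congruence_central_step (G : groupType) (I : finType) (x : I -> G) n
    (A K : set (aut G)) :
  generating x -> nilpotent G ->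
  subgroup A -> subgroup K -> K `<=` A -> finite_index_in A K ->
  A `&` trivial_mod (lower_central n.+2) `<=` K ->
  exists2 m, 0 < m & forall f, A f -> trivial_mod (lower_central n.+1) f ->
    trivial_mod (power_subgroup m) f -> K f.
Proof.
move=> xG nilG sA sK KA [T [c cK]] nK.
pose TG := trivial_mod (@lower_central G n.+1).
have sTG : subgroup TG := trivial_mod_subgroup (lower_central_char G n.+1).
have sW : subgroup (K `&` TG) := subgroup_setI sK sTG.
have WTG : K `&` TG `<=` TG by move=> ? [].
pose D := displacements_nsub x sW WTG.
pose Q : groupType := quotient_group D.
have Qs : forall u : Q, exists v, coset D v = u by apply: coset_surj.
have genQ := generating_surj Qs (generating_ffun (I := I) xG).
have nilQ : nilpotent Q := nilpotent_surj Qs (nilpotent_ffun I nilG).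
pose good t m := forall f, A f -> TG f -> c f = t ->
  trivial_mod (power_subgroup m) f -> K f.
suff ex_good t : exists2 m, 0 < m & good t m.
  have [|t _|m m0 goodm] := @common_multiple _ (enum T) good; last 1 first.
  - by exists m => // f Af TGf; apply: (goodm (c f)); rewrite ?mem_enum.
  - move=> t m k _ gt f Af TGf ft fm; apply: gt => //.
    exact: trivial_modS (@power_subgroupM _ m k) _ fm.
  - exact: ex_good.
have [[f0 [Af0 TGf0 f0t Kf0]]|/forallNP noK] :=
  pselect (exists f, [/\ A f, TG f, c f = t & ~ K f]); last first.
  exists 1%N => // f Af TGf ft _; apply: contrapT => Kf.
  by apply: (noK f).
have Df0 : coset D (displacement x f0) <> 1.
  case/coset_eq1=> w [Kw TGw] wf0.
  have : K (w^-1 * f0).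
    apply: nK; split; first exact: subgroupM sA (subgroupV sA (KA _ Kw)) Af0.
    apply: (trivial_mod_generating (lower_central_char G n.+2) xG) => i.
    apply/(coset_eq (lower_central_nsub G n.+2)).
    have := wf0 i; by rewrite !ffunE !gmulfM => /mulgI/esym.
  by move/(subgroupM sK Kw); rewrite mulVKg.
have [m m0 mf0] := nilpotent_residually_finite genQ nilQ Df0.
exists m => // f Af TGf ft fm; case: mf0.
have Kff0 : K (f^-1 * f0) by apply: cK; rewrite ?ft.
have -> : coset D (displacement x f0) = coset D (displacement x f).
  apply/esym/coset_eq; exists (f^-1 * f0) => [|i].
    by split=> //; apply: subgroupM sTG (subgroupV sTG TGf) TGf0.
  apply: (mulgI (coset (lower_central_nsub G n.+2) (displacement x f i))).
  rewrite -displacementM //; last exact: subgroupM sTG (subgroupV sTG TGf) TGf0.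
  by rewrite mulVKg -gmulfM !ffunE mulVKg.
have sPm : subgroup (coset D @^-1` power_subgroup m).
  exact: subgroup_preimage (generated_subgroup _).
apply: (subgroup_ffun sPm) => i.
apply: (@power_subgroup_morph _ _ (coset D \o ffun_single i) m).
by rewrite ffunE; apply: fm.
Qed.

(** * Finite index *)

Lemma finite_range_colouring (X : Type) (Y : eqType) (h : X -> Y) :
  finite_set (range h) -> exists (T : finType) (c : X -> T),
    forall x y, c x = c y -> h x = h y.
Proof.
case/finite_seqP=> s hs; have sh x : h x \in s.
  suff : range h (h x) by rewrite hs.
  by exists x.
exists 'I_(size s), (fun x => Ordinal (etrans (index_mem (h x) s) (sh x))).
by move=> x y [/(congr1 (nth (h x) s))]; rewrite !nth_index.
Qed.

Lemma finite_index_colouring (G : groupType) (K : set G) :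
  subgroup K -> finite_index K -> finite_index_in [set: G] K.
Proof.
move=> sK /finite_range_colouring[T [c cK]]; exists T, c => x y _ _ /cK xyK.
have : [set y * a | a in K] y by exists 1; [apply: subgroup1|rewrite mulg1].
by rewrite -xyK => -[a Ka <-]; rewrite mulKg.
Qed.

Lemma finite_index_of_colouring (G : groupType) (K : set G) :
  subgroup K -> finite_index_in [set: G] K -> finite_index K.
Proof.
move=> sK [T [c cK]]; pose h x := [set x * a | a in K].
have hc x y : c x = c y -> h x = h y.
  move=> /(cK x y I I) Kxy; apply/seteqP; split=> _ [a Ka <-].
    exists ((x^-1 * y)^-1 * a); last by rewrite invgM invgK -mulgA mulVKg.
    exact: subgroupM sK (subgroupV sK Kxy) Ka.
  exists (x^-1 * y * a); last by rewrite -mulgA mulVKg.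
  exact: subgroupM sK Kxy Ka.
have : range h `<=` [set h (xget 1 [set x | c x = t]) | t in [set: T]].
  move=> _ [x _ <-]; exists (c x) => //; apply: hc.
  exact: (@xgetI _ 1 [set y | c y = c x] x).
by move/sub_finite_set; apply; apply/finite_image/finite_finset.
Qed.

(** Two of the powers of [x] coincide. *)
Lemma finite_group_torsion (G : groupType) : finite_set [set: G] -> torsion G.
Proof.
move=> finG x.
have [|T [c c_inj]] := @finite_range_colouring G G id.
  exact: finite_image.
pose h (i : 'I_#|T|.+1) := c (x ^+ i).
have /injectivePn[i [j ij hij]] : ~~ injectiveb h.
  by apply/injectiveP => /leq_card; rewrite card_ord ltnn.
wlog lt_ij : i j ij hij / i < j => [hw|].
  case: (ltngtP i j) => [|ji|/val_inj/eqP]; first exact: hw.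
    by apply: (hw j i); rewrite // eq_sym.
  by rewrite (negPf ij).
exists (j - i)%N; first by rewrite subn_gt0.
by rewrite expgnFr ?(ltnW lt_ij) // (c_inj _ _ hij) mulgV.
Qed.

(** * Descent along the lower central series *)

(** Let [m] be the exponent given by [congruence_central_step] for [K]. The
induction hypothesis applies to the group [K'] generated by [Tn] and by the
elements of [K] trivial modulo [m]-th powers. If [f = k * t] in [K'] is itself
trivial modulo [m]-th powers, so is [t], whence [t] and [f] are in [K]. *)
Lemma power_congruence_induction (G : groupType) (I : finType) (x : I -> G)
    (A : set (aut G)) n : generating x -> nilpotent G -> subgroup A ->
  let power_congruence n := forall K, subgroup K -> K `<=` A ->
    finite_index_in A K -> A `&` trivial_mod (@lower_central G n) `<=` K ->
    exists2 m, 0 < m & A `&` trivial_mod (@power_subgroup G m) `<=` K in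
  power_congruence 1%N -> power_congruence n.+1.
Proof.
move=> xG nilG sA /= base; elim: n => // n IHn K sK KA finK nK.
have [m m0 mK] := congruence_central_step xG nilG sA sK KA finK nK.
pose Tn := trivial_mod (@lower_central G n.+1).
have charn := lower_central_char G n.+1.
have sTn : subgroup Tn := trivial_mod_subgroup charn.
have nTn : normal Tn := trivial_mod_normal charn.
pose Tm := trivial_mod (@power_subgroup G m).
have sTm : subgroup Tm := trivial_mod_subgroup (power_subgroup_char G m).
pose K' : set (aut G) :=
  [set f | A f /\ exists2 k, (K `&` Tm) k & Tn (k^-1 * f)].
have sKm := subgroup_setI sK sTm.
have [||||m' m'0 m'K] := IHn K'.
- apply/subgroupP;
    split=> [|f g [Af [k Kk kf]] [Ag [l Kl lg]]|f [Af [k Kk kf]]].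
  + split; [exact: subgroup1|exists 1; first exact: subgroup1].
    by rewrite invg1 mul1g; apply: subgroup1.
  + split; [exact: subgroupM|exists (k * l); first exact: subgroupM].
    have -> : (k * l)^-1 * (f * g) = (k^-1 * f) ^ l * (l^-1 * g).
      by rewrite /conjg invgM !mulgA mulgK.
    exact: subgroupM sTn (nTn _ _ kf) lg.
  + split; [exact: subgroupV|exists k^-1; first exact: subgroupV].
    have -> : k^-1^-1 * f^-1 = ((k^-1 * f)^-1) ^ (k^-1).
      by rewrite /conjg invgM invgK !mulgA mulgK.
    exact: nTn (subgroupV sTn kf).
- by move=> f [].
- have [T [c cK]] := finK.
  (* Colour [f] also by its action on the generators modulo [m]-th powers: the
     automorphisms trivial modulo [m]-th powers have finite index. *)
  have [|S [d dP]] := @finite_range_colouring _ _ (coset (power_nsub G m)).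
    apply: sub_finite_set (power_quotient_finite xG nilG m0); exact: subsetT.
  exists (T * {ffun I -> S})%type, (fun f => (c f, [ffun i => d (f (x i))])).
  move=> f g Af Ag [fg_c /ffunP fg_d].
  split; first exact: subgroupM sA (subgroupV sA Af) Ag.
  exists (f^-1 * g); last by rewrite mulVg; apply: subgroup1.
  split; first exact: cK.
  apply: (trivial_mod_generating (power_subgroup_char G m) xG) => i.
  by apply/(coset_eq (power_nsub G m))/dP; have := fg_d i; rewrite !ffunE.
- move=> f [Af nf]; split=> //; exists 1; first exact: subgroup1.
  by rewrite invg1 mul1g.
exists (m * m')%N; first by rewrite muln_gt0 m0.
move=> f [Af fmm].
have fm : Tm f := trivial_modS (@power_subgroupM _ m m') fmm.
have fm' : trivial_mod (@power_subgroup G m') f.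
  by rewrite mulnC in fmm; apply: trivial_modS (@power_subgroupM _ m' m) _ fmm.
have [_ [k [Kk km] kf]] := m'K f (conj Af fm').
have : K (k^-1 * f).
  apply: mK => //; first exact: subgroupM sA (subgroupV sA (KA _ Kk)) Af.
  exact: subgroupM sTm (subgroupV sTm km) fm.
by move/(subgroupM sK Kk); rewrite mulVKg.
Qed.

(** * The congruence subgroup property *)

Lemma nsub_quotient_char (G : groupType) (N : normalSubgroup G) :
  characteristic N -> characteristic (ker (coset N)).
Proof.
suff -> : ker (coset N) = N by [].
by apply/seteqP; split=> x; case: (coset_eq1 N x).
Qed.

Definition char_quotient_of (G : groupType) (N : normalSubgroup G)
    (charN : characteristic N) : charQuotient G :=
  @CharQuotient G (quotient_group N) (coset N) (@coset_surj G N)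
    (nsub_quotient_char charN).

Lemma aut_push_eq1 (G : groupType) (q : charQuotient G) (f : aut G) :
  trivial_mod (ker q) f <-> aut_push q f = 1.
Proof.
split=> [qf|qf x]; last by apply/cq_eq; rewrite -aut_pushE qf.
apply: aut_eq => u; have [x <-] := cq_surj u; rewrite aut_pushE.
exact/esym/cq_eq/qf.
Qed.

Lemma abelianisation_commute (G : groupType) (u v : cq_group (ab G)) :
  commute u v.
Proof.
have [[x <-] [y <-]] := (cq_surj u, cq_surj v).
apply/(commg_mod (derived_nsub G)).
exact: (@lower_central_commg G 0).
Qed.

(** An abelian group has no inner automorphism but the identity. *)
Lemma ker_out_push_ab (G : groupType) (f : aut G) :
  out_push (ab G) (coset (Inn G) f) = 1 <-> trivial_mod (@derived G) f.
Proof.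
have <- : ker (ab G) = @derived G := ker_coset_derived G.
rewrite aut_push_eq1 out_pushE.
split=> [/coset_eq1[g _ <-]|->]; last exact: gmulf1.
apply: aut_eq => u; rewrite /= conjgE.
by rewrite (abelianisation_commute u) mulKg.
Qed.

Section CongruenceSubgroups.
Variables (G L : groupType) (lambda : UMagmaMorphism.type L (Out G)).

Definition lifts (K : set L) : set (aut G) :=
  [set f | exists2 u, K u & lambda u = coset (Inn G) f].

Lemma lifts_subgroup K : subgroup K -> subgroup (lifts K).
Proof.
move=> sK; apply/subgroupP; split=> [|f g [u Ku uf] [v Kv vg]|f [u Ku uf]].
- by exists 1; [apply: subgroup1|rewrite !gmulf1].
- by exists (u * v); [apply: subgroupM|rewrite !gmulfM uf vg].
- by exists u^-1; [apply: subgroupV|rewrite !gmulfV uf].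
Qed.

Lemma lift_exists (u : L) : exists f, lambda u = coset (Inn G) f.
Proof. by have [f fu] := coset_surj (lambda u); exists f. Qed.

Lemma lifts_finite_index K : subgroup K -> ker lambda `<=` K ->
  finite_index K -> finite_index_in (lifts setT) (lifts K).
Proof.
move=> sK kK /(finite_index_colouring sK)[T [c cK]].
pose down f := xget 1 [set u | lambda u = coset (Inn G) f].
have downP f : lifts setT f -> lambda (down f) = coset (Inn G) f.
  by case=> u _ uf; exact: (@xgetI _ 1 [set u | lambda u = coset (Inn G) f] u).
exists T, (c \o down) => f g /downP df /downP dg fg.
exists ((down f)^-1 * down g); first exact: cK.
by rewrite !gmulfM !gmulfV df dg.
Qed.

Hypothesis cspL : CSP (out_push (ab G) \o lambda).

(** [K] contains the inner automorphisms, since they act trivially on the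
abelianisation; so it is the preimage of a subgroup of [L], to which the
hypothesis applies. The kernel of [G -> Q], for the finite quotient [Q] of the
abelianisation that it provides, contains the [m]-th powers if [m] is an
exponent of [Q]. *)
Lemma congruence_abelianisation (K : set (aut G)) :
  subgroup K -> K `<=` lifts setT -> finite_index_in (lifts setT) K ->
  lifts setT `&` trivial_mod (@lower_central G 1) `<=` K ->
  exists2 m, 0 < m & lifts setT `&` trivial_mod (@power_subgroup G m) `<=` K.
Proof.
move=> sK KA [T [c cK]] dK; have sA := lifts_subgroup subgroup_setT.
pose lift u := projT1 (cid (lift_exists u)).
have liftP u : lambda u = coset (Inn G) (lift u).
  exact: projT2 (cid (lift_exists u)).
have liftA u : lifts setT (lift u) by exists u.
have inner_K g : lifts setT (inner g) -> K (inner g).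
  move=> Ag; apply: dK; split=> // x; rewrite /= -commgEl.
  exact: (@lower_central_commg G 0).
have K_coset f g : coset (Inn G) f = coset (Inn G) g -> K f -> K g.
  move=> fg Kf; have /coset_eq[h _ hE] := fg.
  have [u _ uf] := KA f Kf; have Ag : lifts setT g by exists u; rewrite // uf.
  have Kh : K (inner h).
    apply: inner_K; rewrite hE.
    exact: (subgroupM sA (subgroupV sA (KA f Kf)) Ag).
  by rewrite -[g](mulVKg f) -hE; apply: subgroupM.
pose KL : set L := [set u | K (lift u)].
have sKL : subgroup KL.
  apply/subgroupP; split=> [|u v Ku Kv|u Ku].
  - apply: (K_coset 1 (lift 1)); last exact: subgroup1 sK.
    by rewrite -liftP !gmulf1.
  - apply: (K_coset (lift u * lift v) (lift (u * v))).
      by rewrite gmulfM /= -!liftP gmulfM.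
    exact: (subgroupM sK Ku Kv).
  - apply: (K_coset (lift u)^-1 (lift (u^-1))); last exact: (subgroupV sK Ku).
    by rewrite gmulfV /= -!liftP gmulfV.
have finKL : finite_index KL.
  apply: finite_index_of_colouring => //; exists T, (c \o lift) => u v _ _ cuv.
  apply: (K_coset ((lift u)^-1 * lift v) (lift (u^-1 * v))); last by apply: cK.
  by rewrite gmulfM gmulfV /= -!liftP gmulfM gmulfV.
have kerKL : ker (out_push (ab G) \o lambda) `<=` KL.
  move=> u; rewrite /ker /= liftP => /ker_out_push_ab du.
  by apply: dK; split.
have [q [finQ [H [sH KLE]]]] := cspL sKL finKL kerKL.
have [m m0 Qm] := finite_torsion_exponent finQ (finite_group_torsion finQ).
exists m => // f [[u _ uf] fm].
apply: (K_coset (lift u)); first by rewrite -liftP.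
suff : KL u by [].
rewrite KLE /preimage /= uf !out_pushE.
suff -> : aut_push q (aut_push (ab G) f) = 1.
  by rewrite gmulf1; apply: subgroup1.
apply/aut_push_eq1 => v; have [x <-] := cq_surj v.
rewrite aut_pushE -gmulfV -gmulfM /ker /=.
have : subgroup (ker (q \o ab G)).
  exact: (subgroup_preimage (q \o ab G) subgroup_set1).
move/(power_subgroup_sub (m := m)); apply; last exact: fm.
by move=> y; rewrite /ker /= !gmulfXn Qm.
Qed.

(** An automorphism that acts as an inner one on the quotient acts trivially on
it once it is divided by an inner automorphism of [G], and this does not change
its outer class. *)
Lemma congruence_of_power_lift (K : set L) m :
  finite_set [set: quotient_group (power_nsub G m)] ->
  subgroup K -> ker lambda `<=` K ->
  lifts setT `&` trivial_mod (@power_subgroup G m) `<=` lifts K ->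
  congruence_subgroup lambda K.
Proof.
move=> finQ sK kK mK.
pose q := @char_quotient_of G (power_nsub G m) (@power_subgroup_char G m).
exists q; split=> //; exists ((out_push q \o lambda) @` K).
split; first exact: subgroup_image.
apply/seteqP; split=> [u Ku|v [u Ku uv]]; first by exists u.
suff : K (u^-1 * v) by move/(subgroupM sK Ku); rewrite mulVKg.
have [f fE] := lift_exists (u^-1 * v).
have /coset_eq1[g _ gE] : coset (Inn _) (aut_push q f) = 1.
  rewrite /= in uv.
  by rewrite -out_pushE -fE !gmulfM !gmulfV /= -uv mulVg.
have [x xg] := cq_surj g.
have f'E : coset (Inn G) (f * (inner x)^-1) = coset (Inn G) f.
  apply/esym/coset_eq; rewrite mulKg; exists x^-1 => //; exact: gmulfV.
have [|w Kw wE] := mK (f * (inner x)^-1).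
  split; first by exists (u^-1 * v); rewrite // fE f'E.
  have <- : ker q = @power_subgroup G m.
    by apply/seteqP; split=> y; case: (coset_eq1 (power_nsub G m) y).
  by apply/aut_push_eq1; rewrite gmulfM gmulfV /= aut_push_inner xg gE mulgV.
rewrite -[_ * _](mulVKg w); apply: (subgroupM sK Kw); apply: kK.
by rewrite /ker /preimage /= [LHS]gmulfM gmulfV wE f'E fE mulVg.
Qed.

(** The induction is carried up to a trivial term of the lower central series,
modulo which only the identity acts trivially. *)
Theorem CSP_of_abelianisation :
  finitely_generated G -> nilpotent G -> CSP lambda.
Proof.
move=> /finitely_generatedP[I [x xG]] nilG K sK finK kK.
have [c c1] := nilG.
have sA := lifts_subgroup subgroup_setT.
have sKt := lifts_subgroup sK.
have [|||m m0 mK] := @power_congruence_induction _ _ _ _ c xG nilG sA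
  congruence_abelianisation _ sKt.
- by move=> f [u Ku uf]; exists u.
- exact: lifts_finite_index.
- move=> f [_ cf]; have -> : f = 1; last exact: subgroup1.
  apply: aut_eq => y /=; apply: (mulgI y^-1); rewrite mulVg.
  by have /lower_centralS := cf y; rewrite c1.
exact: (congruence_of_power_lift (power_quotient_finite xG nilG m0)).
Qed.

End CongruenceSubgroups.

Theorem theorem4 (G : groupType) (S : pred (Out G))
    (Lambda : subGroupType S) :
  finitely_generated G -> nilpotent G ->
  CSP (out_push (ab G) \o (val : Lambda -> Out G)) ->
  CSP (val : Lambda -> Out G).
Proof. by move=> fgG nilG cspG; apply: CSP_of_abelianisation. Qed.
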